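(* Let $n\ge2$. The isolated subsemigroups of $\mathcal{I}^{\ast}_n$ are exactly $\mathcal{I}^{\ast}_n$, $\mathcal{S}_n$, $\mathcal{I}^{\ast}_n\setminus\mathcal{S}_n$, and the maximal subgroups $G(e)$ where $e$ is an idempotent of rank $n-1$.
   Context: Let $X=\{1,\dots,n\}$, $X'=\{1',\dots,n'\}$. $\mathcal{I}^{\ast}_n$ is the set of partitions of $X\cup X'$ all of whose blocks meet both $X$ and $X'$, with product: regard $\alpha$ as a partition of $X\cup X''$ and $\beta$ as a partition of $X''\cup X'$ ($X''$ a third copy of $X$), and let $\alpha\beta$ be the partition of $X\cup X'$ induced by the equivalence on $X\cup X''\cup X'$ generated by the blocks of both. Rank = number of blocks. $\mathcal{S}_n$ is the group of units (elements all of whose blocks are $\{x,\pi(x)'\}$ for a permutation $\pi$). $G(e)$ is the $\mathcal{H}$-class of the idempotent $e$. A subsemigroup $T$ of a semigroup $S$ is isolated if for all $a\in S$ and $k\ge1$, $a^k\in T$ implies $a\in T$. *)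

(* Defs.v *)
From mathcomp Require Import all_boot all_fingroup.
Set Implicit Arguments. Unset Strict Implicit. Unset Printing Implicit Defensive.

Section DualSym.
Variable n : nat.

(* X ∪ X' : inl x = x, inr x = x' *)
Definition pt := ('I_n + 'I_n)%type.
(* a candidate element: a set of blocks *)
Definition elt := {set {set pt}}.

Definition in_Istar (P : elt) : bool :=
  partition P [set: pt] &&
  [forall B in P, [exists x : 'I_n, inl x \in B] && [exists y : 'I_n, inr y \in B]].

Definition Istar : {set elt} := [set P | in_Istar P].

(* three copies: inl x = x ∈ X, inr (inl x) = x'' ∈ X'', inr (inr x) = x' ∈ X' *)
Definition pt3 := ('I_n + ('I_n + 'I_n))%type.

(* alpha regarded as a partition of X ∪ X'' *)
Definition embA (s : pt) : pt3 :=
  match s with inl x => inl x | inr x => inr (inl x) end.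
(* beta regarded as a partition of X'' ∪ X' *)
Definition embB (s : pt) : pt3 :=
  match s with inl x => inr (inl x) | inr x => inr (inr x) end.
Definition embC (s : pt) : pt3 :=
  match s with inl x => inl x | inr x => inr (inr x) end.

Definition prod_rel (a b : elt) : rel pt3 := fun u v =>
  [exists B in a, (u \in embA @: B) && (v \in embA @: B)] ||
  [exists B in b, (u \in embB @: B) && (v \in embB @: B)].

(* the product: the partition of X ∪ X' induced by the equivalence generated
   (reflexive-transitive closure of the symmetric relation prod_rel) *)
Definition mul (a b : elt) : elt :=
  [set [set t : pt | connect (prod_rel a b) (embC s) (embC t)] | s : pt].

(* k-th power, for k >= 1: pow a 1 = a, pow a (k+1) = pow a k * a *)
Fixpoint pow (a : elt) (k : nat) : elt :=
  match k with
  | 0 => a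
  | 1 => a
  | k'.+1 => mul (pow a k') a
  end.

Definition rank (a : elt) : nat := #|a|.

Definition perm_elt (p : 'S_n) : elt := [set [set inl x; inr (p x)] | x : 'I_n].
Definition Sn : {set elt} := [set perm_elt p | p : 'S_n].

Definition is_idem (e : elt) : bool := mul e e == e.

(* Green's relations in the monoid I*_n (so S^1 = S) *)
Definition Rrel (a b : elt) : bool :=
  [exists x in Istar, a == mul b x] && [exists y in Istar, b == mul a y].
Definition Lrel (a b : elt) : bool :=
  [exists x in Istar, a == mul x b] && [exists y in Istar, b == mul y a].
Definition Hrel (a b : elt) : bool := Rrel a b && Lrel a b.

Definition Hclass (e : elt) : {set elt} := [set a in Istar | Hrel a e].

Definition subsemigroup (T : {set elt}) : Prop :=
  T \subset Istar /\ T != set0 /\ (forall a b, a \in T -> b \in T -> mul a b \in T).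

Definition isolated (T : {set elt}) : Prop :=
  forall a k, a \in Istar -> 1 <= k -> pow a k \in T -> a \in T.

End DualSym.

(* Main.v *)
From Pilot Require Import Defs.
From mathcomp Require Import all_boot all_fingroup.
Import Pilot.Defs.

Set Implicit Arguments. Unset Strict Implicit. Unset Printing Implicit Defensive.

(* Call (L, M) saturated for a when the union of L and M' is a union of blocks of a.
   This relation determines a, is injective and functional, and turns the product
   into relational composition; idempotents become partial identities, determined
   by their domains, which are the families of sets saturated for an equivalence
   on X, so products of idempotents are joins of equivalences.

   Let T be an isolated subsemigroup.
   (1) If an idempotent f of T merges p <> q and also identifies some t outside
   {p, q} with another point, then some idempotent e finer than f that still
   merges p and q lies in T: for a suitable involution g, the element a = e g has
   square f, so a and its inverse lie in T, and so does e = a a^-1.  Hence T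
   contains the idempotent of rank n - 1 merging p and q.
   (2) If T has two distinct idempotents, then its least idempotent z is strictly
   below some idempotent f of T; conjugating z by the transpositions of classes
   of f, which lie in G(f) and so in T, shows that z is the zero.  By (1) all the
   idempotents of rank n - 1 are in T, hence so are all idempotents other than 1,
   which are products of these, and finally all non-units.
   (3) If T has only one idempotent e, then T consists of the elements having e
   as a power; either e = 1, or e has rank n - 1 by (1). *)

(** * Saturated pairs as a faithful representation *)

Section Saturated.
Variable n : nat.
Implicit Types (a b e f : elt n) (s t : pt n) (x y p q : 'I_n).
Implicit Types (L M K : {set 'I_n}) (T : {set elt n}).

Definition side L M s : bool :=
  match s with inl x => x \in L | inr y => y \in M end.

Definition same a s t : bool := [exists B in a, (s \in B) && (t \in B)].

(* [sat a] is, as a relation on subsets, a partial injection: it is the faithful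
   representation of the dual symmetric inverse monoid in which [mul] becomes
   the composition of relations. *)
Definition sat a L M : bool :=
  [forall s, forall t, same a s t ==> (side L M s == side L M t)].

Lemma satP a L M :
  reflect (forall s t, same a s t -> side L M s = side L M t) (sat a L M).
Proof.
apply: (iffP forallP) => [h s t st|h s].
  by have /forallP/(_ t)/implyP/(_ st)/eqP := h s.
by apply/forallP => t; apply/implyP => /h/eqP.
Qed.

Lemma same_sym a s t : same a s t = same a t s.
Proof. by apply: eq_existsb => B; rewrite (andbC (s \in B)). Qed.

Lemma in_IstarP a : reflect
  [/\ partition a [set: pt n],
      forall B, B \in a -> exists x, inl x \in B &
      forall B, B \in a -> exists y, inr y \in B] (a \in Istar n).
Proof.
rewrite inE; apply: (iffP andP) => [[ha hB]|[ha hl hr]]; split=> //.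
- by move=> B Ba; have /andP[/existsP] := forall_inP hB _ Ba.
- by move=> B Ba; have /andP[_ /existsP] := forall_inP hB _ Ba.
by apply/forall_inP => B Ba; apply/andP; split; apply/existsP; auto.
Qed.

Lemma samexx a s : a \in Istar n -> same a s s.
Proof.
case/in_IstarP=> /and3P[/eqP ca _ _] _ _.
have: s \in cover a by rewrite ca inE.
by case/bigcupP => B Ba sB; apply/existsP; exists B; rewrite Ba sB.
Qed.

Lemma sameE a s t : a \in Istar n -> same a s t = (t \in pblock a s).
Proof.
case/in_IstarP=> /and3P[/eqP ca tI _] _ _.
apply/existsP/idP => [[B /and3P[Ba sB tB]]|tp].
  by rewrite (def_pblock tI Ba sB).
exists (pblock a s); rewrite tp pblock_mem ?mem_pblock ca inE //.
Qed.

Lemma same_trans a : a \in Istar n -> transitive (same a).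
Proof.
move=> ia t s u; rewrite !sameE //.
case/in_IstarP: ia => /and3P[_ tI _] _ _.
by move=> /(same_pblock tI)->.
Qed.

Lemma same_l a s : a \in Istar n -> exists x, same a s (inl x).
Proof.
move=> ia; have := samexx s ia; case/in_IstarP: ia => _ hl _.
case/existsP=> B /and3P[Ba sB _]; have [x xB] := hl B Ba.
by exists x; apply/existsP; exists B; rewrite Ba sB.
Qed.

Lemma same_r a s : a \in Istar n -> exists y, same a s (inr y).
Proof.
move=> ia; have := samexx s ia; case/in_IstarP: ia => _ _ hr.
case/existsP=> B /and3P[Ba sB _]; have [x xB] := hr B Ba.
by exists x; apply/existsP; exists B; rewrite Ba sB.
Qed.

(** The block of [s] is the test pair through which [same] is recovered from [sat]. *)
Lemma sat_same a s : a \in Istar n ->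
  sat a [set x | same a s (inl x)] [set y | same a s (inr y)].
Proof.
move=> ia; apply/satP => t u tu.
have E v : side [set x | same a s (inl x)] [set y | same a s (inr y)] v = same a s v.
  by case: v => v; rewrite /= inE.
rewrite !E; apply/idP/idP => h; apply: same_trans h _ => //.
by rewrite same_sym.
Qed.

Lemma same_eq a b : a \in Istar n -> b \in Istar n ->
  (forall s t, same a s t = same b s t) -> a = b.
Proof.
move=> ia ib h.
have hp s : pblock a s = pblock b s by apply/setP => t; rewrite -!sameE.
have sub c d : c \in Istar n -> (forall s, pblock c s = pblock d s) ->
    d \in Istar n -> c \subset d.
  move=> ic hcd id_; apply/subsetP => B Bc.
  case/in_IstarP: ic => /and3P[_ tI _] hl _; have [x xB] := hl _ Bc.
  rewrite -(def_pblock tI Bc xB) hcd pblock_mem //.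
  by case/in_IstarP: id_ => /and3P[/eqP -> _ _]; rewrite inE.
by apply/eqP; rewrite eqEsubset !sub.
Qed.

Lemma sat_ext a b : a \in Istar n -> b \in Istar n -> sat a =2 sat b -> a = b.
Proof.
have sub c d s t : c \in Istar n -> d \in Istar n -> sat c =2 sat d -> same c s t -> same d s t.
  move=> ic id_ h st; have := sat_same s id_; rewrite -h => /satP/(_ _ _ st).
  have E v : side [set x | same d s (inl x)] [set y | same d s (inr y)] v = same d s v.
    by case: v => v; rewrite /= inE.
  by rewrite !E samexx.
move=> ia ib h; apply: same_eq => // s t.
by apply/idP/idP; apply: sub.
Qed.

Lemma sat_sameE a L M x y : sat a L M -> same a (inl x) (inr y) -> (x \in L) = (y \in M).
Proof. by move=> /satP h /h. Qed.

(** Every point of X' shares a block with some point of X, so [L] decides its membership. *)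
Lemma sat_fun a L M K : a \in Istar n -> sat a L M -> sat a L K -> M = K.
Proof.
move=> ia hM hK; apply/setP => y; have [x] := same_l (inr y) ia.
by rewrite same_sym => xy; rewrite -(sat_sameE hM xy) (sat_sameE hK xy).
Qed.

Lemma sat_inj a L M K : a \in Istar n -> sat a L K -> sat a M K -> L = M.
Proof.
move=> ia hM hK; apply/setP => x; have [y xy] := same_r (inl x) ia.
by rewrite (sat_sameE hM xy) (sat_sameE hK xy).
Qed.

(** * Elements given by equivalence relations *)

Definition elt_of (r : rel (pt n)) : elt n := [set [set t | r s t] | s : pt n].

Lemma same_elt_of (r : rel (pt n)) s t :
  equivalence_rel r -> same (elt_of r) s t = r s t.
Proof.
move=> er; apply/existsP/idP => [[B /and3P[/imsetP[u _ ->]]]|st].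
  by rewrite !inE => us ut; rewrite -(er u s t).2.
by exists [set u | r s u]; rewrite !inE st (er s s s).1 imset_f.
Qed.

Lemma elt_of_Istar (r : rel (pt n)) : equivalence_rel r ->
  (forall s, exists x, r s (inl x)) -> (forall s, exists y, r s (inr y)) ->
  elt_of r \in Istar n.
Proof.
move=> er hl hr; apply/in_IstarP; split.
- have -> : elt_of r = equivalence_partition r [set: pt n].
    by apply/setP => B; apply/imsetP/imsetP => -[s _ ->]; exists s;
      rewrite ?inE //; apply/setP => t; rewrite !inE.
  by apply: equivalence_partitionP => s t u _ _ _; apply: er.
- by move=> B /imsetP[s _ ->]; have [x h] := hl s; exists x; rewrite !inE.
- by move=> B /imsetP[s _ ->]; have [x h] := hr s; exists x; rewrite !inE.
Qed.

(** * The product as composition of relations *)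

Lemma prod_rel_sym a b : symmetric (prod_rel a b).
Proof.
move=> u v; rewrite /prod_rel; congr (_ || _);
  by apply: eq_existsb => B; congr (_ && _); rewrite andbC.
Qed.

Lemma connect_prod_sym a b : connect_sym (prod_rel a b).
Proof. exact/sym_connect_sym/prod_rel_sym. Qed.

Lemma connect_prod_equiv a b :
  equivalence_rel (fun s t => connect (prod_rel a b) (embC s) (embC t)).
Proof.
move=> s t u; split=> [|st]; first exact: connect0.
exact: same_connect (connect_prod_sym a b) _ _ st _.
Qed.

Lemma mulE a b :
  mul a b = elt_of (fun s t => connect (prod_rel a b) (embC s) (embC t)).
Proof. by []. Qed.

Lemma same_mul a b s t :
  same (mul a b) s t = connect (prod_rel a b) (embC s) (embC t).
Proof. by rewrite mulE same_elt_of //; apply: connect_prod_equiv. Qed.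

Lemma prod_relA a b s t : same a s t -> prod_rel a b (embA s) (embA t).
Proof.
case/existsP=> B /and3P[Ba sB tB]; apply/orP; left.
by apply/existsP; exists B; rewrite Ba !imset_f.
Qed.

Lemma prod_relB a b s t : same b s t -> prod_rel a b (embB s) (embB t).
Proof.
case/existsP=> B /and3P[Ba sB tB]; apply/orP; right.
by apply/existsP; exists B; rewrite Ba !imset_f.
Qed.

Lemma mul_Istar a b : a \in Istar n -> b \in Istar n -> mul a b \in Istar n.
Proof.
move=> ia ib; rewrite mulE; apply: elt_of_Istar (connect_prod_equiv a b) _ _.
  case=> [x|y]; first by exists x; apply: connect0.
  have [z yz] := same_l (inr y) ib; have [x zx] := same_l (inr z) ia.
  exists x; apply: connect_trans (connect1 (prod_relA b zx)).
  exact: connect1 (prod_relB a yz).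
case=> [x|y]; last by exists y; apply: connect0.
have [z xz] := same_r (inl x) ia; have [y zy] := same_r (inl z) ib.
exists y; apply: connect_trans (connect1 (prod_relB a zy)).
exact: connect1 (prod_relA b xz).
Qed.

(** From left to right, [K] is the trace on X'' of the connected components that meet [L] or M'.
    Conversely, [L], [K] and [M] together two-colour the three copies so that each generating edge
    is monochromatic, and hence each path. *)
Lemma sat_mul a b L M :
  reflect (exists2 K, sat a L K & sat b K M) (sat (mul a b) L M).
Proof.
apply: (iffP (satP _ _ _)) => [h|[K /satP hL /satP hM] s t].
  pose col u := [exists s, side L M s && connect (prod_rel a b) (embC s) u].
  have colE s : col (embC s) = side L M s.
    apply/existsP/idP => [[t /andP[tL ts]]|sL].
      by rewrite -(h t s) // same_mul.
    by exists s; rewrite sL connect0.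
  have colP u v : prod_rel a b u v -> col u = col v.
    move=> uv; apply: eq_existsb => s; congr (_ && _).
    by apply: (same_connect_r (connect_prod_sym a b)); apply: connect1.
  exists [set y | col (inr (inl y))]; apply/satP => s t.
    have E u : side L [set y | col (inr (inl y))] u = col (embA u).
      by case: u => u; rewrite /= ?inE //; exact: esym (colE (inl u)).
    by rewrite !E => /(prod_relA b)/colP.
  have E u : side [set y | col (inr (inl y))] M u = col (embB u).
    by case: u => u; rewrite /= ?inE //; exact: esym (colE (inr u)).
  by rewrite !E => /(prod_relB a)/colP.
rewrite same_mul.
pose col (u : pt3 n) := match u with
  inl x => x \in L | inr (inl y) => y \in K | inr (inr z) => z \in M end.
have E u : side L M u = col (embC u) by case: u.
have colP u v : prod_rel a b u v -> col u = col v.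
  case/orP => /existsP[B /and3P[Ba /imsetP[s' sB ->] /imsetP[t' tB ->]]].
    have /hL : same a s' t' by apply/existsP; exists B; rewrite Ba sB.
    by case: (s') (t') => ? [].
  have /hM : same b s' t' by apply/existsP; exists B; rewrite Ba sB.
  by case: (s') (t') => ? [].
rewrite !E => /connectP[w]; elim: w (embC s) => [u _ -> //|v w IH u /=].
by case/andP=> /colP -> pw /(IH _ pw).
Qed.

Lemma mulA a b e : a \in Istar n -> b \in Istar n -> e \in Istar n ->
  mul a (mul b e) = mul (mul a b) e.
Proof.
move=> ia ib ie; apply: sat_ext; rewrite ?mul_Istar // => L M.
apply/sat_mul/sat_mul => -[K].
  by move=> h1 /sat_mul[N h2 h3]; exists N => //; apply/sat_mul; exists K.
by move=> /sat_mul[N h2 h3] h1; exists N => //; apply/sat_mul; exists K.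
Qed.

(** Pairs x, y' suffice because every block meets both X and X'. *)
Lemma sat_crossP a L M : a \in Istar n ->
  reflect (forall x y, same a (inl x) (inr y) -> (x \in L) = (y \in M)) (sat a L M).
Proof.
move=> ia; apply: (iffP idP) => [h x y|h]; first exact: sat_sameE.
have E x y s : same a (inl x) s -> same a (inl x) (inr y) -> side L M s = (x \in L).
  case: s => [z xz xy|z xz _]; last by rewrite (h x z).
  by rewrite /= (h _ _ xy) (h z y) // (same_trans ia _ xy) // same_sym.
apply/satP => s t st; have [x] := same_l s ia; rewrite same_sym => xs.
have [y xy] := same_r (inl x) ia.
by rewrite (E x y s) // (E x y t) // (same_trans ia xs).
Qed.

(** * Domains and the equivalences induced on X *)

Definition dom a : {set {set 'I_n}} := [set L | [exists M, sat a L M]].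

Lemma domP a L : reflect (exists M, sat a L M) (L \in dom a).
Proof. by rewrite inE; apply: existsP. Qed.

Lemma dom_memP a L : a \in Istar n ->
  reflect (forall x y, same a (inl x) (inl y) -> (x \in L) = (y \in L)) (L \in dom a).
Proof.
move=> ia; apply: (iffP (domP a L)) => [[M /satP h] x y /h //|h].
exists [set y | [exists x in L, same a (inl x) (inr y)]].
apply/sat_crossP => // x y xy; rewrite inE; apply/idP/existsP => [xL|[z /andP[zL zy]]].
  by exists x; rewrite xL.
by rewrite (h x z) //; apply: same_trans xy _; rewrite // same_sym.
Qed.

Lemma same_domP a x y : a \in Istar n ->
  reflect (forall L, L \in dom a -> (x \in L) = (y \in L)) (same a (inl x) (inl y)).
Proof.
move=> ia; apply: (iffP idP) => [xy L /(dom_memP _ ia)|h]; first exact.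
have D : [set z | same a (inl x) (inl z)] \in dom a.
  by apply/domP; eexists; apply: sat_same.
by have := h _ D; rewrite !inE samexx // => <-.
Qed.

(** The order is reversed: the coarser the equivalence on X, the fewer its saturated sets. *)
Lemma dom_subP a b : a \in Istar n -> b \in Istar n ->
  reflect (forall x y, same b (inl x) (inl y) -> same a (inl x) (inl y))
          (dom a \subset dom b).
Proof.
move=> ia ib; apply: (iffP subsetP) => [ab x y /(same_domP _ _ ib) h|ab L].
  by apply/same_domP => // L /ab/h.
by move=> /(dom_memP _ ia) h; apply/dom_memP => // x y /ab/h.
Qed.

Lemma dom_mul a b : dom (mul a b) \subset dom a.
Proof.
by apply/subsetP => L /domP[M /sat_mul[K h _]]; apply/domP; exists K.
Qed.

(** * Inverses, obtained by exchanging X and X' *)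

Definition swap s : pt n := match s with inl x => inr x | inr x => inl x end.

Definition conv a : elt n := elt_of (fun s t => same a (swap s) (swap t)).

Lemma conv_equiv a : a \in Istar n ->
  equivalence_rel (fun s t => same a (swap s) (swap t)).
Proof.
move=> ia s t u; split=> [|st]; first exact: samexx.
apply/idP/idP; last exact: same_trans.
by apply: same_trans => //; rewrite same_sym.
Qed.

Lemma same_conv a s t : a \in Istar n -> same (conv a) s t = same a (swap s) (swap t).
Proof. by move=> ia; rewrite same_elt_of //; apply: conv_equiv. Qed.

Lemma conv_Istar a : a \in Istar n -> conv a \in Istar n.
Proof.
move=> ia; apply: elt_of_Istar (conv_equiv ia) _ _ => s.
  by have [y] := same_r (swap s) ia; exists y.
by have [x] := same_l (swap s) ia; exists x.
Qed.

Lemma sat_conv a L M : a \in Istar n -> sat (conv a) L M = sat a M L.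
Proof.
move=> ia; apply/(sat_crossP _ _ (conv_Istar ia))/(sat_crossP _ _ ia) => h x y.
  by move=> xy; rewrite (h y x) // same_conv // same_sym.
by rewrite same_conv // same_sym => /h.
Qed.

Lemma convK a : a \in Istar n -> conv (conv a) = a.
Proof. by move=> ia; apply: sat_ext => [||L M]; rewrite ?sat_conv ?conv_Istar. Qed.

Lemma conv_mul a b : a \in Istar n -> b \in Istar n ->
  conv (mul a b) = mul (conv b) (conv a).
Proof.
move=> ia ib; apply: sat_ext => [||L M]; rewrite ?conv_Istar ?mul_Istar ?conv_Istar //.
rewrite sat_conv ?mul_Istar //; apply/sat_mul/sat_mul => -[K h1 h2];
  by exists K; rewrite ?sat_conv // -sat_conv.
Qed.

(** * Idempotents as partial identities *)

Lemma is_idemP e : e \in Istar n ->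
  reflect (forall L M, sat e L M -> L = M) (is_idem e).
Proof.
move=> ie; apply: (iffP eqP) => [ee L M h|h].
  move: (h); rewrite -ee => /sat_mul[K h1 h2].
  by apply: (sat_inj ie h); rewrite {1}(sat_fun ie h h1).
apply: sat_ext; rewrite ?mul_Istar // => L M; apply/sat_mul/idP => [[K h1 h2]|h1].
  by rewrite (h _ _ h1).
by exists M => //; move: (h1); rewrite (h _ _ h1).
Qed.

Lemma sat_idem e L M : e \in Istar n -> is_idem e ->
  sat e L M = (L == M) && (L \in dom e).
Proof.
move=> ie /is_idemP-/(_ ie) h; apply/idP/andP => [LM|[/eqP <- /domP[K LK]]].
  by split; [apply/eqP; apply: h | apply/domP; exists M].
by rewrite {2}(h _ _ LK).
Qed.

Lemma idem_ext e f : e \in Istar n -> is_idem e -> f \in Istar n -> is_idem f ->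
  dom e = dom f -> e = f.
Proof. by move=> ie ee jf ff ef; apply: sat_ext => // L M; rewrite !sat_idem // ef. Qed.

Lemma idem_mul e f : e \in Istar n -> is_idem e -> f \in Istar n -> is_idem f ->
  is_idem (mul e f).
Proof.
move=> ie ee jf ff; apply/is_idemP; rewrite ?mul_Istar // => L M /sat_mul[K].
by rewrite !sat_idem // => /andP[/eqP-> _] /andP[/eqP].
Qed.

Lemma dom_idem_mul e f : e \in Istar n -> is_idem e -> f \in Istar n -> is_idem f ->
  dom (mul e f) = dom e :&: dom f.
Proof.
move=> ie ee jf ff; apply/setP => L; rewrite in_setI.
apply/domP/andP => [[M /sat_mul[K]]|[eL fL]].
  by rewrite !sat_idem // => /andP[/eqP <- ->] /andP[_ ->].
by exists L; apply/sat_mul; exists L; rewrite sat_idem // eqxx.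
Qed.

Lemma idem_conv a : a \in Istar n -> is_idem (mul a (conv a)).
Proof.
move=> ia; apply/is_idemP; rewrite ?mul_Istar ?conv_Istar // => L M /sat_mul[K].
by rewrite sat_conv //; apply: sat_inj.
Qed.

Lemma dom_mul_conv a : a \in Istar n -> dom (mul a (conv a)) = dom a.
Proof.
move=> ia; apply/eqP; rewrite eqEsubset dom_mul; apply/subsetP => L /domP[K LK].
by apply/domP; exists L; apply/sat_mul; exists K; rewrite ?sat_conv.
Qed.

Lemma dom_conv_idem e : e \in Istar n -> is_idem e -> dom (conv e) = dom e.
Proof.
move=> ie ee; apply/setP => L; apply/domP/domP => -[M h]; exists M; move: h;
by rewrite sat_conv // !sat_idem // => /andP[/eqP ->->]; rewrite eqxx.
Qed.

(** * Powers *)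

Lemma pow_Istar a k : a \in Istar n -> pow a k \in Istar n.
Proof. by move=> ia; elim: k => [//|[//|k] IH]; apply: mul_Istar. Qed.

Lemma powS a k : 0 < k -> pow a k.+1 = mul (pow a k) a.
Proof. by case: k. Qed.

(** Both exponents are successors because [pow a 0] is by convention [a], not the identity. *)
Lemma powD a i j : a \in Istar n ->
  pow a (i.+1 + j.+1) = mul (pow a i.+1) (pow a j.+1).
Proof.
move=> ia; elim: j => [|j IH]; first by rewrite addn1.
by rewrite addnS powS ?addn_gt0 // IH (@powS a j.+1) // mulA // pow_Istar.
Qed.

Lemma pow_closed (T : {set elt n}) a k :
  (forall b c, b \in T -> c \in T -> mul b c \in T) -> a \in T -> pow a k \in T.
Proof. by move=> Tm aT; elim: k => [//|[//|k] IH]; apply: Tm. Qed.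

Lemma idem_pow a : a \in Istar n -> exists2 k, 0 < k & is_idem (pow a k).
Proof.
move=> ia; pose g (i : 'I_#|elt n|.+1) := pow a i.+1.
have [i [j lij gij]] : exists i, exists2 j, i < j & pow a i.+1 = pow a j.+1.
  have /injectivePn[i [j ij gij]] : ~~ injectiveb g.
    by apply/negP => /injectiveP/leq_card; rewrite card_ord ltnn.
  case: (ltngtP i j) ij => [lij _|lji _|/val_inj->]; last by rewrite eqxx.
    by exists i, j.
  by exists j, i.
have per m : pow a (i + m).+1 = pow a (i + m + (j - i)).+1.
  case: m => [|m]; first by rewrite addn0 subnKC // ltnW.
  have E u : (u + m.+1).+1 = u.+1 + m.+1 by rewrite addSn.
  by rewrite addnAC (subnKC (ltnW lij)) !E !powD //; congr mul.
have perk m r : i < m -> pow a m = pow a (m + r * (j - i)).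
  move=> im; elim: r => [|r IH]; first by rewrite addn0.
  rewrite IH mulSnr addnA; set N := m + _.
  have -> : N = (i + (N - i.+1)).+1.
    by rewrite -addSn subnKC // (leq_trans im) // leq_addr.
  by rewrite per addSn.
have k0 : 0 < i.+1 * (j - i) by rewrite muln_gt0 subn_gt0.
(* This exponent is a multiple of the period [j - i] and exceeds the index [i], so doubling it does
   not change the power. *)
exists (i.+1 * (j - i)) => //; rewrite /is_idem; apply/eqP.
have im : i < i.+1 * (j - i) by rewrite leq_pmulr ?subn_gt0.
rewrite [RHS](perk _ i.+1) //; case: (i.+1 * (j - i)) k0 => // k _.
by rewrite powD.
Qed.

End Saturated.

Section Examples.
Variable n : nat.
Implicit Types (a b e f : elt n) (s t : pt n) (x y p q : 'I_n).
Implicit Types (L M K : {set 'I_n}) (T : {set elt n}).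

Lemma dom_pow a k : dom (pow a k) \subset dom a.
Proof. by elim: k => [//|[//|k] IH]; apply: subset_trans (dom_mul _ _) IH. Qed.

Lemma cod_pow a k : a \in Istar n -> dom (conv (pow a k)) \subset dom (conv a).
Proof.
move=> ia; case: k => [//|[//|k]].
by rewrite powS // conv_mul ?pow_Istar // dom_mul.
Qed.

(** * Elements given by colourings of X and X' *)

Definition color (C : Type) (l r : 'I_n -> C) s : C :=
  match s with inl x => l x | inr y => r y end.

(** The blocks are the fibres of the colouring. They all meet both copies when [l] and [r] have the
    same image, which is what [lr] and [rl] below express. *)
Definition mk (C : eqType) (l r : 'I_n -> C) : elt n :=
  elt_of (fun s t => color l r s == color l r t).

Section Mk.
Variables (C : eqType) (l r : 'I_n -> C).

Lemma same_mk s t : same (mk l r) s t = (color l r s == color l r t).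
Proof. by rewrite same_elt_of // => u v w; split=> // /eqP->. Qed.

Hypothesis lr : forall x, exists y, l x = r y.
Hypothesis rl : forall y, exists x, l x = r y.

Lemma mk_Istar : mk l r \in Istar n.
Proof.
apply: elt_of_Istar => [u v w|[x|y]|[x|y]] /=.
- by split=> // /eqP->.
- by exists x.
- by have [x <-] := rl y; exists x.
- by have [y ->] := lr x; exists y.
- by exists y.
Qed.

Lemma sat_mkP L M :
  reflect (forall x y, l x = r y -> (x \in L) = (y \in M)) (sat (mk l r) L M).
Proof.
apply: (iffP (sat_crossP _ _ mk_Istar)) => h x y xy; apply: h.
  by rewrite same_mk /= xy.
by move: xy; rewrite same_mk => /eqP.
Qed.

End Mk.

Section Mk1.
Variables (C : eqType) (c : 'I_n -> C).

Lemma mk1_Istar : mk c c \in Istar n.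
Proof. by apply: mk_Istar => x; exists x. Qed.

Lemma mk1_idem : is_idem (mk c c).
Proof.
apply/is_idemP; first exact: mk1_Istar.
move=> L M /sat_mkP h; apply/setP => x; apply: h => // {}x; by exists x.
Qed.

Lemma dom_mk1P L :
  reflect (forall x y, c x = c y -> (x \in L) = (y \in L)) (L \in dom (mk c c)).
Proof.
apply: (iffP (dom_memP _ mk1_Istar)) => h x y xy; apply: h.
  by rewrite same_mk /= xy.
by move: xy; rewrite same_mk => /eqP.
Qed.

End Mk1.

(** The block of [x] serves as the colour naming its class on X. *)
Definition cls e x : {set pt n} := pblock e (inl x).

Lemma eq_cls e x y : e \in Istar n -> (cls e x == cls e y) = same e (inl x) (inl y).
Proof.
move=> ie; rewrite sameE //; case/in_IstarP: ie => /and3P[/eqP ce tI _] _ _.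
by rewrite /cls eq_pblock // ce inE.
Qed.

Lemma cls_imset e : e \in Istar n -> e = cls e @: setT.
Proof.
case/in_IstarP=> /and3P[/eqP ce tI _] hl _; apply/setP => B.
apply/idP/imsetP => [Be|[x _ ->]]; last by rewrite pblock_mem // ce inE.
by have [x xB] := hl _ Be; exists x; rewrite // /cls (def_pblock tI Be xB).
Qed.

(** * Units *)

Lemma perm_elt_mk (g : 'S_n) : perm_elt g = mk g id.
Proof.
have E x : [set inl x; inr (g x)] =
    [set t | color g id (inl x) == color g id t] :> {set pt n}.
  apply/setP => -[y|y]; rewrite !inE /=; first by rewrite orbF (inj_eq perm_inj) eq_sym.
  by rewrite eq_sym.
apply/setP => B; apply/imsetP/imsetP => [[x _ ->]|[[x|y] _ ->]].
- by exists (inl x).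
- by exists x.
exists (g^-1%g y) => //; rewrite E; apply/setP => t; rewrite !inE /=.
by rewrite permKV.
Qed.

Lemma perm_Istar (g : 'S_n) : perm_elt g \in Istar n.
Proof.
rewrite perm_elt_mk; apply: mk_Istar => x; first by exists (g x).
by exists (g^-1%g x); rewrite permKV.
Qed.

Lemma sat_permP (g : 'S_n) L M :
  reflect (forall x, (x \in L) = (g x \in M)) (sat (perm_elt g) L M).
Proof.
have h1 x : exists y, g x = id y by exists (g x).
have h2 y : exists x, g x = id y by exists (g^-1%g y); rewrite permKV.
rewrite perm_elt_mk; apply: (iffP (sat_mkP h1 h2 _ _)) => h x; first exact: h.
by move=> y <-.
Qed.

Lemma dom_perm (g : 'S_n) : dom (perm_elt g) = setT.
Proof.
apply/setP => L; rewrite in_setT; apply/domP; exists (g @: L).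
by apply/sat_permP => x; rewrite mem_imset //; apply: perm_inj.
Qed.

Lemma conv_perm (g : 'S_n) : conv (perm_elt g) = perm_elt g^-1.
Proof.
apply: sat_ext; rewrite ?conv_Istar ?perm_Istar // => L M.
rewrite sat_conv ?perm_Istar //; apply/sat_permP/sat_permP => h x.
  by rewrite h permKV.
by rewrite h permK.
Qed.

(** When every singleton is saturated, no two points of X share a block, so choosing for each x some
    y' in its block gives an injection, that is, a permutation. *)
Lemma Sn_dom a : a \in Istar n -> (a \in Sn n) = (dom a == setT).
Proof.
move=> ia; apply/imsetP/eqP => [[g _ ->]|ha]; first exact: dom_perm.
have ker x y : same a (inl x) (inl y) -> x = y.
  move=> /(same_domP _ _ ia)/(_ [set y]); rewrite ha in_setT !inE eqxx.
  by move=> /(_ isT)/eqP.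
(* The default [x] is never taken, since the block of [x] meets X'. *)
pose g x := odflt x [pick y | same a (inl x) (inr y)].
have gP x : same a (inl x) (inr (g x)).
  rewrite /g; case: pickP => //= h; have [y] := same_r (inl x) ia.
  by rewrite h.
have gI : injective g.
  move=> x y xy; apply: ker; apply: (same_trans ia (gP x)).
  by rewrite xy same_sym.
exists (perm gI) => //; apply: sat_ext => //; first exact: perm_Istar.
have sub L M : sat a L M -> sat (perm_elt (perm gI)) L M.
  by move=> h; apply/sat_permP => x; rewrite permE; apply: sat_sameE h _.
move=> L M; apply/idP/idP; first exact: sub.
have /domP[K LK] : L \in dom a by rewrite ha in_setT.
by move=> /(sat_fun (perm_Istar _) (sub _ _ LK)) <-.
Qed.

Lemma Sn_Istar : Sn n \subset Istar n.
Proof. by apply/subsetP => a /imsetP[g _ ->]; apply: perm_Istar. Qed.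

Lemma Sn_mul a b : a \in Sn n -> b \in Sn n -> mul a b \in Sn n.
Proof.
case/imsetP=> g _ -> /imsetP[h _ ->]; rewrite Sn_dom ?mul_Istar ?perm_Istar //.
apply/eqP/setP => L; rewrite in_setT; apply/domP.
have /domP[K LK] : L \in dom (perm_elt g) by rewrite dom_perm in_setT.
have /domP[M KM] : K \in dom (perm_elt h) by rewrite dom_perm in_setT.
by exists M; apply/sat_mul; exists K.
Qed.

Lemma Sn_pow a k : a \in Istar n -> (pow a k \in Sn n) = (a \in Sn n).
Proof.
move=> ia; apply/idP/idP => [|/pow_closed]; last by apply; apply: Sn_mul.
rewrite !Sn_dom ?pow_Istar // => /eqP h; have := dom_pow a k.
by rewrite h subTset.
Qed.

(** * Idempotents of rank n - 1 *)

Definition merge p q x := if x == p then q else x.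

Definition pair_idem p q : elt n := mk (merge p q) (merge p q).

Lemma mergeE p q x y : p != q -> merge p q x = merge p q y ->
  [\/ x = y, x = p /\ y = q | x = q /\ y = p].
Proof.
rewrite /merge; case: (eqVneq x p) => [->|xp]; case: (eqVneq y p) => [->|yp] _.
- by constructor 1.
- by constructor 2.
- by constructor 3.
- by constructor 1.
Qed.

Lemma dom_pairE p q L : p != q -> (L \in dom (pair_idem p q)) = ((p \in L) == (q \in L)).
Proof.
move=> pq; apply/dom_mk1P/eqP => [h|h x y].
  by apply: h; rewrite /merge eqxx; case: eqP.
by case/(mergeE pq) => [->|[-> ->]|[-> ->]].
Qed.

Lemma pair_idem_of_same e p q : p != q -> e \in Istar n -> is_idem e ->
  (forall x y, same e (inl x) (inl y) <-> merge p q x = merge p q y) ->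
  e = pair_idem p q.
Proof.
move=> pq ie ee h; apply: idem_ext; rewrite ?mk1_Istar ?mk1_idem //.
apply/setP => L; apply/(dom_memP _ ie)/dom_mk1P => H x y xy; apply: H; exact/h.
Qed.

Lemma rank_pair p q : p != q -> rank (pair_idem p q) = n.-1.
Proof.
move=> pq; set e := pair_idem p q; have ie : e \in Istar n := mk1_Istar _.
have E x y : cls e x = cls e y <-> merge p q x = merge p q y.
  split; first by move/eqP; rewrite eq_cls // same_mk => /eqP.
  by move=> h; apply/eqP; rewrite eq_cls // same_mk; apply/eqP.
rewrite /rank (cls_imset ie).
have -> : cls e @: setT = cls e @: [set~ p].
  apply/setP => B; apply/imsetP/imsetP => -[x _ ->]; last by exists x.
  exists (merge p q x); first by rewrite !inE /merge; case: (eqVneq x p) => // _; rewrite eq_sym.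
  apply/E; rewrite /merge; case: (eqVneq x p) => [_|/negPf->] //.
  by rewrite eq_sym (negPf pq).
rewrite card_in_imset ?cardsC1 ?card_ord // => x y; rewrite !inE => xp yp /E.
by rewrite /merge (negPf xp) (negPf yp).
Qed.

Lemma idem_rank_pair e : 0 < n -> e \in Istar n -> is_idem e -> rank e = n.-1 ->
  exists p q, p != q /\ e = pair_idem p q.
Proof.
move=> n0 ie ee re.
have /injectivePn[p [q pq clspq]] : ~~ injectiveb (cls e).
  apply/negP => /injectiveP cI; move: re; rewrite /rank (cls_imset ie).
  rewrite card_imset // cardsT card_ord => E.
  by move: n0; rewrite -ltn_predL -E ltnn.
(* By counting: [q] replaces [p], so the n - 1 points other than [p] still reach all n - 1
   blocks. *)
have clsI : {in [set~ p] &, injective (cls e)}.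
  suff img : cls e @: [set~ p] = e.
    by apply/imset_injP; rewrite img cardsC1 card_ord -re.
  rewrite [RHS](cls_imset ie); apply/setP => B.
  apply/imsetP/imsetP => -[x _ ->]; first by exists x.
  case: (eqVneq x p) => [->|xp]; last by exists x; rewrite ?inE.
  by exists q; rewrite ?clspq // !inE eq_sym.
exists p, q; split=> //; apply: pair_idem_of_same => // x y.
rewrite -eq_cls //; split=> [/eqP|]; last first.
  by case/(mergeE pq) => [->|[-> ->]|[-> ->]]; rewrite ?clspq.
rewrite /merge; case: (eqVneq x p) => [->|xp]; case: (eqVneq y p) => [->|yp] //.
- by rewrite clspq => /clsI -> //; rewrite !inE // eq_sym.
- by rewrite clspq => /clsI -> //; rewrite !inE // eq_sym.
- by move/clsI; rewrite !inE; apply.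
Qed.

(** * Maximal subgroups *)

Lemma HclassE e a : e \in Istar n -> is_idem e -> a \in Istar n ->
  (a \in Hclass e) = (dom a == dom e) && (dom (conv a) == dom e).
Proof.
move=> ie ee ia; rewrite inE ia /= /Hrel /Rrel /Lrel.
apply/andP/andP => [[/andP[h1 h2] /andP[h3 h4]]|[/eqP da /eqP ca]].
  case/exists_inP: h1 => x ix /eqP ax; case/exists_inP: h2 => y iy /eqP ay.
  case/exists_inP: h3 => z iz /eqP az; case/exists_inP: h4 => w iw /eqP aw.
  have ce := dom_conv_idem ie ee.
  rewrite !eqEsubset; split; apply/andP; split.
  - by rewrite ax dom_mul.
  - by rewrite {1}ay dom_mul.
  - by rewrite -ce az conv_mul ?dom_mul.
  - by rewrite -ce {1}aw conv_mul ?dom_mul.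
(* The witnesses are [a] and its inverse: a = e a = a e and e = a a^-1 = a^-1 a. *)
split; apply/andP; split; apply/exists_inP.
- exists a => //; apply/eqP/sat_ext; rewrite ?mul_Istar // => L M.
  apply/idP/sat_mul => [h|[K]]; last by rewrite sat_idem // => /andP[/eqP->].
  by exists L; rewrite // sat_idem // eqxx -da; apply/domP; exists M.
- exists (conv a); first exact: conv_Istar.
  apply/eqP/idem_ext; rewrite ?mul_Istar ?conv_Istar ?idem_conv //.
  by rewrite dom_mul_conv.
- exists a => //; apply/eqP/sat_ext; rewrite ?mul_Istar // => L M.
  apply/idP/sat_mul => [h|[K h]]; last by rewrite sat_idem // => /andP[/eqP<-].
  exists M; rewrite // sat_idem // eqxx -ca; apply/domP; exists L.
  by rewrite sat_conv.
- exists (conv a); first exact: conv_Istar.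
  rewrite -[X in mul _ X](convK ia).
  apply/eqP/idem_ext; rewrite ?mul_Istar ?idem_conv ?conv_Istar //.
  by rewrite dom_mul_conv ?conv_Istar.
Qed.

(** The image of [a] is the domain of [b], so the composition loses no set. *)
Lemma dom_mul_eq a b D : a \in Istar n -> b \in Istar n ->
  dom a = D -> dom (conv a) = D -> dom b = D -> dom (mul a b) = D.
Proof.
move=> ia ib da ca db; apply/eqP; rewrite eqEsubset -{1}da dom_mul.
apply/subsetP => L; rewrite -da => /domP[K LK].
have : K \in dom b by rewrite db -ca; apply/domP; exists L; rewrite sat_conv.
by case/domP => M KM; apply/domP; exists M; apply/sat_mul; exists K.
Qed.

Lemma Hclass_subsemigroup e : e \in Istar n -> is_idem e -> subsemigroup (Hclass e).
Proof.
move=> ie ee; split; first by apply/subsetP => a; rewrite inE => /andP[].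
split; first by apply/set0Pn; exists e; rewrite (HclassE ie ee ie) dom_conv_idem // eqxx.
move=> a b ha hb.
have ia : a \in Istar n by move: ha; rewrite inE => /andP[].
have ib : b \in Istar n by move: hb; rewrite inE => /andP[].
move: ha hb; rewrite (HclassE ie ee ia) (HclassE ie ee ib).
rewrite (HclassE ie ee (mul_Istar ia ib)).
move=> /andP[/eqP da /eqP ca] /andP[/eqP db /eqP cb].
rewrite (dom_mul_eq ia ib da ca db) eqxx conv_mul //.
by rewrite (dom_mul_eq (conv_Istar ib) (conv_Istar ia) cb) ?convK ?eqxx.
Qed.

(** The equivalence merging only [p] and [q] is minimal among the nontrivial ones, and a non-unit
    induces a nontrivial one. *)
Lemma dom_pair_max p q a : p != q -> a \in Istar n ->
  dom (pair_idem p q) \subset dom a -> a \notin Sn n -> dom a = dom (pair_idem p q).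
Proof.
move=> pq ia sub aS; apply/eqP; rewrite eqEsubset sub andbT.
have apq : same a (inl p) (inl q).
  apply: contraR aS => apq; rewrite Sn_dom // -subTset; apply/subsetP => L _.
  apply/dom_memP => // x y xy.
  have : merge p q x = merge p q y.
    by apply/eqP; have /dom_subP/(_ _ _ xy) := sub; rewrite mk1_Istar same_mk => ->.
  case/(mergeE pq) => [->//|[xp yq]|[xq yp]]; first by rewrite xp yq (negPf apq) in xy.
  by rewrite xq yp same_sym (negPf apq) in xy.
apply/subsetP => L /(dom_memP _ ia)/(_ _ _ apq) h.
by rewrite dom_pairE // h.
Qed.

Lemma conv_Sn a : a \in Istar n -> (conv a \in Sn n) = (a \in Sn n).
Proof.
have sub b : b \in Sn n -> conv b \in Sn n.
  by case/imsetP => g _ ->; rewrite conv_perm imset_f.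
by move=> ia; apply/idP/idP => /sub //; rewrite convK.
Qed.

(** Taking powers can only shrink the domains of [a] and of its inverse. As [a] is not a unit,
    [dom_pair_max] leaves no room for them to be larger than that of [e]. *)
Lemma Hclass_pair_isolated p q : p != q -> isolated (Hclass (pair_idem p q)).
Proof.
move=> pq a k ia _; set e := pair_idem p q.
have ie : e \in Istar n := mk1_Istar _; have ee : is_idem e := mk1_idem _.
rewrite (HclassE ie ee (pow_Istar k ia)) (HclassE ie ee ia) => /andP[/eqP dk /eqP ck].
have aS : a \notin Sn n.
  apply/negP; rewrite -(Sn_pow k) // Sn_dom ?pow_Istar // dk => /eqP eT.
  have : [set p] \in dom e by rewrite eT in_setT.
  by rewrite dom_pairE // !inE eqxx [q == p]eq_sym (negPf pq).
rewrite (dom_pair_max pq ia) //; last by rewrite -/e -dk dom_pow.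
rewrite (dom_pair_max pq (conv_Istar ia)) ?eqxx ?conv_Sn //.
by rewrite -/e -ck cod_pow.
Qed.

End Examples.

(** * Idempotents forced into an isolated subsemigroup *)

Section Isolated.
Variables (n : nat) (T : {set elt n}).
Hypothesis TI : T \subset Istar n.
Hypothesis Tmul : forall a b, a \in T -> b \in T -> mul a b \in T.
Hypothesis Tiso : isolated T.
Implicit Types (a b e f : elt n) (p q r s t x y : 'I_n) (L M K : {set 'I_n}).

Lemma isolated_sq a : a \in Istar n -> mul a a \in T -> a \in T.
Proof. by move=> ia; apply: (Tiso (k := 2)). Qed.

Lemma isolated_idem_pow a : a \in T ->
  exists2 k, 0 < k & is_idem (pow a k) /\ pow a k \in T.
Proof.
move=> aT; have [k k0 ek] := idem_pow (subsetP TI _ aT).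
by exists k => //; split=> //; apply: pow_closed.
Qed.

(** The second component of the colour cuts [t] off as a singleton class and leaves the other points
    grouped as before. *)
Definition split f t : elt n :=
  mk (fun x => (cls f x, x == t)) (fun x => (cls f x, x == t)).

Lemma same_split f t x y : f \in Istar n ->
  same (split f t) (inl x) (inl y) = same f (inl x) (inl y) && ((x == t) == (y == t)).
Proof. by move=> jf; rewrite same_mk /= xpair_eqE eq_cls. Qed.

(** With a = e g, the square of [a] is the identity on those L for which both L and its image under
    [g] are saturated for [e]. As [g t] and [g t'] differ from [t], they stay together in [e], so
    the second condition glues [t] back to [t'] and the square is [f]. *)
Lemma split_isolated f (g : 'S_n) t t' :
  f \in T -> is_idem f -> (forall x, g (g x) = x) ->
  (forall x y, same f (inl x) (inl y) -> same f (inl (g x)) (inl (g y))) ->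
  same f (inl t) (inl t') -> t' != t -> g t != t -> g t' != t ->
  split f t \in T.
Proof.
move=> fT ff gg gf tt' t't gt gt'; set e := split f t.
have jf := subsetP TI _ fT.
have ie : e \in Istar n := mk1_Istar _; have ee : is_idem e := mk1_idem _.
have ip := perm_Istar g.
have fe L : L \in dom f -> L \in dom e.
  apply: subsetP; apply/dom_subP => // x y; rewrite same_split //.
  by case/andP.
have gK L K : (forall x, (x \in L) = (g x \in K)) -> K = [set x | g x \in L].
  by move=> h; apply/setP => x; rewrite inE h gg.
have fg L : L \in dom f -> [set x | g x \in L] \in dom f.
  move=> /(dom_memP _ jf) h; apply/dom_memP => // x y /gf/h.
  by rewrite !inE.
have ef L : L \in dom e -> [set x | g x \in L] \in dom e -> L \in dom f.
  move=> /(dom_memP _ ie) hL /(dom_memP _ ie) hg.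
  have htt' : (t \in L) = (t' \in L).
    have := hg (g t) (g t'); rewrite !inE !gg; apply.
    by rewrite same_split // gf // (negPf gt) (negPf gt').
  have ht y : same f (inl t) (inl y) -> (t \in L) = (y \in L).
    case: (eqVneq y t) => [-> //|yt] ty; rewrite htt'; apply: hL.
    rewrite same_split // (negPf yt) (negPf t't) eqxx andbT.
    by apply: same_trans ty; rewrite // same_sym.
  apply/dom_memP => // x y xy.
  case: (eqVneq x t) => [xt|xt]; first by rewrite xt; apply: ht; rewrite -xt.
  case: (eqVneq y t) => [yt|yt].
    by rewrite yt; apply/esym/ht; rewrite -yt same_sym.
  by apply: hL; rewrite same_split // (negPf xt) (negPf yt) xy.
pose a := mul e (perm_elt g).
have ia : a \in Istar n by rewrite mul_Istar.
have aP L K : sat a L K <-> L \in dom e /\ K = [set x | g x \in L].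
  split=> [/sat_mul[M]|[Le ->]].
    by rewrite sat_idem // => /andP[/eqP <- ->] /sat_permP/gK.
  apply/sat_mul; exists L; first by rewrite sat_idem // eqxx.
  by apply/sat_permP => x; rewrite inE gg.
have aaf : mul a a = f.
  apply: sat_ext; rewrite ?mul_Istar // => L M; rewrite (sat_idem _ _ jf ff).
  have ggL : L = [set x | g x \in [set y | g y \in L]].
    by apply/setP => x; rewrite !inE gg.
  apply/sat_mul/andP => [[K /aP[Le ->] /aP[Ke ->]]|[/eqP <- Lf]].
    by rewrite -ggL eqxx; split=> //; apply: ef.
  exists [set x | g x \in L]; apply/aP; first by split=> //; apply: fe.
  by split=> //; apply/fe/fg.
(* An idempotent is its own inverse, so the inverse of [a] also squares to [f]. *)
have convf : conv f = f.
  apply: sat_ext; rewrite ?conv_Istar // => L M; rewrite sat_conv // !sat_idem //.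
  by rewrite eq_sym; case: eqP => // ->.
have aT : a \in T by apply: isolated_sq; rewrite ?aaf.
have cT : conv a \in T.
  by apply: isolated_sq; rewrite ?conv_Istar // -conv_mul // aaf convf.
suff -> : e = mul a (conv a) by apply: Tmul.
apply: idem_ext; rewrite ?mul_Istar ?conv_Istar ?idem_conv // dom_mul_conv //.
apply/eqP; rewrite eqEsubset (dom_mul e (perm_elt g) : dom a \subset dom e) andbT.
apply/subsetP => L Le; by apply/domP; exists [set x | g x \in L]; apply/aP.
Qed.

(** In a class with three points, the transposition of [x] and [t] preserves the class, moves [t]
    and fixes [y], which plays the part of [t']. *)
Lemma split_class3 f x y t : f \in T -> is_idem f ->
  same f (inl t) (inl x) -> same f (inl t) (inl y) ->
  x != y -> x != t -> y != t -> split f t \in T.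
Proof.
move=> fT ff tx ty xy xt yt; have jf := subsetP TI _ fT.
have gz z : same f (inl (tperm x t z)) (inl z).
  case: tpermP => [->|->|_ _]; rewrite ?samexx //.
  by rewrite same_sym.
apply: (@split_isolated f (tperm x t) t y) => //.
- exact: tpermK.
- move=> u v uv; apply: (same_trans jf (gz u)); apply: (same_trans jf uv).
  by rewrite same_sym.
- by rewrite tpermR.
- by rewrite tpermD // eq_sym.
Qed.

(** The involution exchanging [p] with [s] and [q] with [r] swaps the two classes, so it takes both
    [s] and [r] away from [s]. *)
Lemma split_class22 f p q r s : f \in T -> is_idem f -> p != q -> r != s ->
  (forall z, same f (inl p) (inl z) = (z == p) || (z == q)) ->
  (forall z, same f (inl r) (inl z) = (z == r) || (z == s)) ->
  ~~ same f (inl p) (inl r) -> split f s \in T.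
Proof.
move=> fT ff pq rs hp hr pr; have jf := subsetP TI _ fT.
have /andP[rp rq] : (r != p) && (r != q) by move: pr; rewrite hp negb_or.
have sr : same f (inl s) (inl r) by rewrite same_sym hr eqxx orbT.
have /andP[sp sq] : (s != p) && (s != q).
  by rewrite -negb_or -hp; apply: contra pr => ps; apply: same_trans ps sr.
pose g := (tperm p s * tperm q r)%g.
have gp : g p = s by rewrite permM tpermL tpermD // eq_sym.
have gs : g s = p by rewrite permM tpermR tpermD // eq_sym.
have gq : g q = r by rewrite permM (@tpermD _ p) // tpermL.
have gr : g r = q by rewrite permM (@tpermD _ p) ?tpermR // eq_sym.
have gD z : z != p -> z != q -> z != r -> z != s -> g z = z.
  by move=> zp zq zr zs; rewrite permM !tpermD // eq_sym.
have gg z : g (g z) = z.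
  case: (eqVneq z p) => [->|zp]; first by rewrite gp.
  case: (eqVneq z q) => [->|zq]; first by rewrite gq.
  case: (eqVneq z r) => [->|zr]; first by rewrite gr.
  case: (eqVneq z s) => [->|zs]; first by rewrite gs.
  by rewrite !gD.
have pqf : same f (inl p) (inl q) by rewrite hp eqxx orbT.
have hq z : same f (inl q) (inl z) -> (z == p) || (z == q).
  by move=> qz; rewrite -hp; apply: same_trans pqf qz.
have hs z : same f (inl s) (inl z) -> (z == r) || (z == s).
  by move=> sz; rewrite -hr; apply: same_trans sz; rewrite // same_sym.
have C u : (u == p) || (u == q) || ((u == r) || (u == s)) ->
    forall v, same f (inl u) (inl v) -> same f (inl (g u)) (inl (g v)).
  case/orP => /orP[] /eqP -> v.
  - by rewrite hp => /orP[] /eqP->; rewrite ?gp ?gq // samexx.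
  - by move/hq => /orP[] /eqP->; rewrite ?gp ?gq ?samexx // same_sym.
  - by rewrite hr => /orP[] /eqP->; rewrite ?gr ?gs ?samexx // same_sym.
  - by move/hs => /orP[] /eqP->; rewrite ?gr ?gs ?samexx.
apply: (@split_isolated f g s r) => //; last 2 first.
- by rewrite gs eq_sym.
- by rewrite gr eq_sym.
move=> u v uv.
case Hu : ((u == p) || (u == q) || ((u == r) || (u == s))); first exact: C.
case Hv : ((v == p) || (v == q) || ((v == r) || (v == s))).
  by rewrite same_sym; apply: C; rewrite // same_sym.
move/negbT: Hu; rewrite !negb_or => /andP[/andP[? ?] /andP[? ?]].
move/negbT: Hv; rewrite !negb_or => /andP[/andP[? ?] /andP[? ?]].
by rewrite !gD.
Qed.

(* Among the idempotents of T merging p and q, one with the largest domain merges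
   nothing else: otherwise splitting off another point enlarges the domain. *)
Lemma pair_idem_isolated f p q : f \in T -> is_idem f -> p != q ->
  same f (inl p) (inl q) -> pair_idem p q \in T.
Proof.
move=> fT ff pq fpq.
pose P h := [&& h \in T, is_idem h & same h (inl p) (inl q)].
have Pf : P f by apply/and3P.
case: (arg_maxnP (fun h : elt n => #|dom h|) Pf) => h /and3P[hT hh hpq] hmax.
have ih := subsetP TI _ hT.
(* Splitting off [t] would make {t} a new saturated set, against the maximality of [h]. *)
have noS t t' : t != p -> t != q -> t' != t -> same h (inl t) (inl t') ->
    split h t \notin T.
  move=> tp tq t't tt'; apply/negP => sT.
  have : P (split h t).
    rewrite /P sT mk1_idem same_split // hpq.
    by rewrite [p == t]eq_sym [q == t]eq_sym (negPf tp) (negPf tq).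
  move/hmax => /=; rewrite leqNgt => /negP; apply; apply: proper_card.
  apply/properP; split.
    by apply/dom_subP; rewrite ?mk1_Istar // => x y; rewrite same_split // => /andP[].
  exists [set t].
    apply/dom_memP; rewrite ?mk1_Istar // => x y; rewrite same_split // !inE.
    by case/andP=> _ /eqP.
  apply/negP => /(dom_memP _ ih)/(_ _ _ tt'); rewrite !inE eqxx.
  by rewrite (negPf t't).
have no3 x y t : t != p -> t != q -> same h (inl t) (inl x) ->
    same h (inl t) (inl y) -> x != t -> y != t -> x = y.
  move=> tp tq tx ty xt yt; apply/eqP; apply: contraT => xy.
  have := noS t x tp tq xt tx.
  by rewrite (split_class3 hT hh tx ty).
have clp z : same h (inl p) (inl z) = (z == p) || (z == q).
  apply/idP/orP => [pz|[/eqP->|/eqP->//]]; last exact: samexx.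
  apply/orP; apply: contraT; rewrite negb_or => /andP[zp zq].
  have /eqP : p = q; last by rewrite (negPf pq).
  apply: (no3 p q z) => //; rewrite 1?[_ == z]eq_sym //; first by rewrite same_sym.
  by apply: same_trans hpq; rewrite // same_sym.
have alone t t' : t != p -> t != q -> t' != t -> ~~ same h (inl t) (inl t').
  move=> tp tq t't; apply/negP => tt'.
  have ptN : ~~ same h (inl p) (inl t') .
    apply/negP => pt'; have : same h (inl p) (inl t).
      by apply: same_trans pt' _; rewrite // same_sym.
    by rewrite clp (negPf tp) (negPf tq).
  have := noS t t' tp tq t't tt'.
  (* By [no3] the class of [t] is {t, t'}; together with {p, q} it gives the two classes of two
     points. *)
  rewrite (@split_class22 h p q t' t) // => z.
  apply/idP/orP => [t'z|[/eqP->|/eqP->]]; rewrite ?samexx // 1?same_sym //.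
  case: (eqVneq z t) => [->|zt]; [by right | left; apply/eqP].
  by apply: (no3 _ _ t) => //; apply: same_trans tt' t'z.
suff <- : h = pair_idem p q by [].
apply: pair_idem_of_same => // x y; split=> [xy|]; last first.
  by case/(mergeE pq) => [->|[-> ->]|[-> ->]]; rewrite ?samexx // same_sym.
case: (eqVneq x y) => [-> //|xNy].
have tw u v : u != v -> same h (inl u) (inl v) -> (u == p) || (u == q).
  move=> uv h1; apply: contraT; rewrite negb_or => /andP[up uq].
  by have := alone u v up uq; rewrite eq_sym uv h1; apply.
have := tw x y xNy xy; have := tw y x; rewrite eq_sym same_sym => /(_ xNy xy).
rewrite /merge => /orP[] /eqP-> /orP[] /eqP->; rewrite ?eqxx //;
  by case: eqP.
Qed.

(* The element u of G(f) transposing the classes of w and q lies in T, so the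
   idempotent u z u lies in T and is above z. *)
Lemma dom_transposed f z w q L : f \in T -> is_idem f -> z \in T -> is_idem z ->
  (forall h, h \in T -> is_idem h -> dom z \subset dom h) -> L \in dom z ->
  exists2 K, K \in dom z & forall x y,
    cls f x = tperm (cls f w) (cls f q) (cls f y) -> (x \in L) = (y \in K).
Proof.
move=> fT ff zT zz zmin Lz; have jf := subsetP TI _ fT; have iz := subsetP TI _ zT.
set tau := tperm _ _.
have tauc x : exists y, tau (cls f x) = cls f y.
  by rewrite /tau; case: tpermP => _; [exists q | exists w | exists x].
have lr x : exists y, cls f x = tau (cls f y).
  by have [y h] := tauc x; exists y; rewrite -h tpermK.
have rl y : exists x, cls f x = tau (cls f y).
  by have [x h] := tauc y; exists x.
(* [u] links each class of [f] on X to its image under [tau] on X'; since [tau] is an involution,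
   [u] squares to [f]. *)
pose u := mk (cls f) (fun y => tau (cls f y)).
have iu : u \in Istar n by apply: mk_Istar.
have uP M K : sat u M K -> forall x y, cls f x = tau (cls f y) -> (x \in M) = (y \in K).
  by move/(sat_mkP lr rl).
have uu : mul u u = f.
  apply: sat_ext; rewrite ?mul_Istar // => M N; rewrite (sat_idem _ _ jf ff).
  apply/sat_mul/andP => [[K MK KN]|[/eqP <- Mf]].
    have E x y : cls f x = cls f y -> (x \in M) = (y \in N).
      move=> xy; have [v hv] := lr x; rewrite (uP _ _ MK x v) //.
      by apply: (uP _ _ KN); rewrite -xy hv tpermK.
    have MN : M = N by apply/setP => x; apply: E.
    split; first by apply/eqP.
    apply/dom_memP => // x y; rewrite -eq_cls // => /eqP xy.
    by rewrite (E x y) // MN.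
  exists [set y | [exists x in M, cls f x == tau (cls f y)]].
    apply/(sat_mkP lr rl) => x y xy; rewrite inE.
    apply/idP/exists_inP => [xM|[v vM /eqP vy]]; first by exists x; rewrite ?xy.
    move/(dom_memP _ jf): Mf => /(_ x v) -> //.
    by rewrite -eq_cls // xy vy.
  apply/(sat_mkP lr rl) => x y xy; rewrite inE.
  apply/exists_inP/idP => [[v vM /eqP vx]|yM].
    move/(dom_memP _ jf): Mf => /(_ y v) -> //.
    by rewrite -eq_cls // vx xy tpermK.
  by exists y => //; rewrite xy tpermK.
have uT : u \in T by apply: isolated_sq; rewrite ?uu.
have uzu : is_idem (mul u (mul z u)).
  apply/is_idemP; rewrite ?mul_Istar // => M N /sat_mul[K MK /sat_mul[K']].
  rewrite sat_idem // => /andP[/eqP <- _] KN.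
  by apply: (is_idemP jf ff); rewrite -uu; apply/sat_mul; exists K.
(* Since [z] is least, [L] lies in the domain of u z u, and its image [K] under [u] must then lie in
   that of [z]. *)
have /subsetP/(_ _ Lz)/domP[N] := zmin _ (Tmul uT (Tmul zT uT)) uzu.
case/sat_mul=> K LK /sat_mul[K']; rewrite sat_idem // => /andP[_ Kz] _.
by exists K => //; apply: uP.
Qed.

(** * Subsemigroups with two distinct idempotents *)

Lemma two_idem_pairs f1 f2 : f1 \in T -> is_idem f1 -> f2 \in T -> is_idem f2 ->
  f1 != f2 -> forall x y, x != y -> pair_idem x y \in T.
Proof.
move=> f1T ff1 f2T ff2 f12.
pose P h := (h \in T) && is_idem h.
have Pf : P f1 by apply/andP.
case: (arg_minnP (fun h : elt n => #|dom h|) Pf) => z /andP[zT zz] zmin'.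
have iz := subsetP TI _ zT.
(* Multiplying idempotents intersects their domains, so a domain of least size is contained in all
   the others. *)
have zmin h : h \in T -> is_idem h -> dom z \subset dom h.
  move=> hT hh; have ih := subsetP TI _ hT.
  have <- : dom z :&: dom h = dom z.
    apply/eqP; rewrite eqEcard subsetIl -dom_idem_mul //=.
    by apply: zmin'; rewrite /P Tmul ?idem_mul.
  exact: subsetIr.
have [f fT [ff fz]] : exists2 f, f \in T & is_idem f /\ f != z.
  case: (eqVneq f1 z) => [f1z|]; last by exists f1.
  by exists f2; rewrite // -f1z eq_sym.
have jf := subsetP TI _ fT.
have /existsP[p /existsP[q /andP[zpq fpq]]] :
    [exists p, exists q, same z (inl p) (inl q) && ~~ same f (inl p) (inl q)].
  apply: contraT => /existsPn h; case/eqP: fz; apply: idem_ext => //.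
  apply/eqP; rewrite eqEsubset zmin // andbT; apply/dom_subP => // x y xy.
  by have := h x; rewrite negb_exists => /forallP/(_ y); rewrite xy /= negbK.
(* If [w] lies in the class of [p] under [f], use that [z] merges [p] and [q]. Otherwise transposing
   the classes of [w] and [q] fixes that of [p]; since [K] too contains both or neither of [p] and
   [q], [w] is in [L] exactly when [p] is. Hence [z] merges all points. *)
have key w L : L \in dom z -> (w \in L) = (q \in L).
  move=> Lz; apply/eqP; apply: contraT => wq.
  have [K Kz LK] := dom_transposed w q fT ff zT zz zmin Lz.
  have Lpq := same_domP _ _ iz zpq L Lz.
  have Lf : L \in dom f by apply: subsetP Lz; apply: zmin.
  have pw : cls f p != cls f w.
    apply: contra wq; rewrite eq_cls // => pw.
    by rewrite -(dom_memP _ jf Lf _ _ pw) Lpq.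
  have pq : cls f p != cls f q by rewrite eq_cls.
  have := same_domP _ _ iz zpq K Kz.
  rewrite -(LK w q) ?tpermR // -(LK p p) ?tpermD 1?eq_sym // Lpq => E.
  by rewrite E eqxx in wq.
move=> x y xy; apply: (pair_idem_isolated zT zz xy).
by apply/same_domP => // L Lz; rewrite !(key _ _ Lz).
Qed.

Lemma exists_merged e : e \in Istar n -> e \notin Sn n ->
  exists p q, p != q /\ same e (inl p) (inl q).
Proof.
move=> ie eS.
have /existsP[p /existsP[q /andP[pq epq]]] :
    [exists p, exists q, (p != q) && same e (inl p) (inl q)].
  apply: contraR eS => /existsPn h; rewrite Sn_dom // -subTset.
  apply/subsetP => L _; apply/dom_memP => // x y xy.
  by have := h x; rewrite negb_exists => /forallP/(_ y); rewrite xy andbT negbK => /eqP->.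
by exists p, q.
Qed.

(** Among the idempotents of [T] above [e], take one with the smallest domain. If it failed to merge
    two points merged by [e], multiplying it by their [pair_idem] would shrink the domain
    further. *)
Lemma idem_of_pairs : (forall p q, p != q -> pair_idem p q \in T) ->
  forall e, e \in Istar n -> is_idem e -> e \notin Sn n -> e \in T.
Proof.
move=> pT e ie ee eS; have [p [q [pq epq]]] := exists_merged ie eS.
have sub x y : x != y -> same e (inl x) (inl y) -> dom e \subset dom (pair_idem x y).
  move=> xy exy; apply/subsetP => L /(dom_memP _ ie)/(_ _ _ exy) h.
  by rewrite dom_pairE // h.
pose P h := [&& h \in T, is_idem h & dom e \subset dom h].
have Pp : P (pair_idem p q) by rewrite /P pT // mk1_idem sub.
case: (arg_minnP (fun h : elt n => #|dom h|) Pp) => h /and3P[hT hh eh] hmin.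
have ih := subsetP TI _ hT.
suff -> : e = h by [].
apply: idem_ext => //; apply/eqP; rewrite eqEsubset eh; apply/dom_subP => // x y exy.
apply: contraT => hxy.
have xy : x != y by apply: contra hxy => /eqP->; apply: samexx.
have ip : pair_idem x y \in Istar n := mk1_Istar _.
have dk : dom (mul h (pair_idem x y)) = dom h :&: dom (pair_idem x y).
  by rewrite dom_idem_mul ?mk1_idem.
have : P (mul h (pair_idem x y)).
  by rewrite /P Tmul ?pT // idem_mul ?mk1_idem // dk subsetI eh sub.
move/hmin; rewrite dk leqNgt => /negP[]; apply: proper_card.
rewrite properEneq subsetIl andbT; apply: contra hxy => /eqP/setIidPl/subsetP hp.
by apply/same_domP => // L /hp; rewrite dom_pairE // => /eqP.
Qed.

End Isolated.

(** * The four families and the classification *)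

Lemma idem_Sn_eq n (e f : elt n) :
  is_idem e -> e \in Sn n -> is_idem f -> f \in Sn n -> e = f.
Proof.
move=> ee eS ff fS; have [ie jf] := (subsetP (Sn_Istar n) _ eS, subsetP (Sn_Istar n) _ fS).
by apply: idem_ext => //; move: eS fS; rewrite !Sn_dom // => /eqP-> /eqP->.
Qed.

Lemma Istar_isolated n : subsemigroup (Istar n) /\ isolated (Istar n).
Proof.
split; last by [].
split=> //; split; last exact: mul_Istar.
by apply/set0Pn; exists (perm_elt 1); apply: perm_Istar.
Qed.

Lemma Sn_isolated n : subsemigroup (Sn n) /\ isolated (Sn n).
Proof.
split; last by move=> a k ia _; rewrite Sn_pow.
split; first exact: Sn_Istar.
split; last exact: Sn_mul.
by apply/set0Pn; exists (perm_elt 1); apply: imset_f.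
Qed.

Lemma nonunits_isolated n : 1 < n ->
  subsemigroup (Istar n :\: Sn n) /\ isolated (Istar n :\: Sn n).
Proof.
move=> n1; split; last first.
  by move=> a k ia _; rewrite !in_setD Sn_pow // ia andbT => /andP[].
split; first exact: subsetDl.
split.
  pose x0 : 'I_n := Ordinal (ltnW n1); pose x1 : 'I_n := Ordinal n1.
  pose e := pair_idem x0 x1; have ie : e \in Istar n := mk1_Istar _.
  apply/set0Pn; exists e; rewrite in_setD ie andbT Sn_dom //.
  apply/eqP => /setP/(_ [set x0]).
  by rewrite in_setT dom_pairE // !inE.
move=> a b; rewrite !in_setD => /andP[aS ia] /andP[_ ib].
rewrite mul_Istar // andbT Sn_dom ?mul_Istar //; apply: contra aS => /eqP h.
by rewrite Sn_dom // -subTset -h dom_mul.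
Qed.

Lemma isolated_cases n (T : {set elt n}) : subsemigroup T -> isolated T ->
  [\/ T = Istar n, T = Sn n, T = Istar n :\: Sn n |
      exists p q, p != q /\ T = Hclass (pair_idem p q)].
Proof.
move=> [TI [/set0Pn[a0 a0T] Tm]] Ti.
have [k0 _ [ee eT]] := isolated_idem_pow TI Tm a0T.
move: (pow a0 k0) ee eT => e ee eT; have ie := subsetP TI _ eT.
case: (boolP [exists f in T, is_idem f && (f != e)]).
  case/exists_inP=> f fT /andP[ff fe].
  have nonunit a : a \in Istar n -> a \notin Sn n -> a \in T.
    move=> ia aS; have [k k1 ak] := idem_pow ia; apply: (Ti a k) => //.
    apply: (idem_of_pairs TI Tm) => //; rewrite ?pow_Istar ?Sn_pow //.
    exact: (two_idem_pairs TI Tm Ti fT ff eT ee fe).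
  (* A single unit in [T] brings in all of them: the identity is a power of it, and of every other
     unit. *)
  case: (boolP [exists a in T, a \in Sn n]) => [/exists_inP[a aT aS]|/exists_inPn nS].
    constructor 1; apply/eqP; rewrite eqEsubset TI; apply/subsetP => b ib.
    case: (boolP (b \in Sn n)) => [bS|]; last exact: nonunit.
    have ia := subsetP TI _ aT.
    have [k k1 [ak akT]] := isolated_idem_pow TI Tm aT.
    have [j j1 bj] := idem_pow ib; apply: (Ti b j) => //.
    suff -> : pow b j = pow a k by [].
    by apply: idem_Sn_eq; rewrite ?Sn_pow.
  constructor 3; apply/setP => a; rewrite in_setD; apply/idP/andP => [aT|[aS ia]].
    by split; [apply: nS | apply: subsetP aT].
  exact: nonunit.
move=> /exists_inPn uniq.
have powe a : a \in T -> exists2 k, 0 < k & pow a k = e.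
  move=> aT; have [k k1 [ak akT]] := isolated_idem_pow TI Tm aT.
  by exists k => //; apply/eqP; have := uniq _ akT; rewrite ak /= negbK.
case: (boolP (e \in Sn n)) => eS.
  constructor 2; apply/setP => a; apply/idP/idP => [aT|aS].
    have [k k1 ake] := powe a aT.
    by rewrite -(Sn_pow k) ?(subsetP TI _ aT) // ake.
  have ia := subsetP (Sn_Istar n) _ aS.
  have [k k1 ak] := idem_pow ia; apply: (Ti a k) => //.
  suff -> : pow a k = e by [].
  by apply: idem_Sn_eq; rewrite ?Sn_pow.
have [p [q [pq epq]]] := exists_merged ie eS.
have pT := pair_idem_isolated TI Tm Ti eT ee pq epq.
have pe : pair_idem p q = e.
  by apply/eqP; have := uniq _ pT; rewrite mk1_idem /= negbK.
constructor 4; exists p, q; split=> //; rewrite pe.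
have eH : e \in Hclass e by rewrite (HclassE ie ee ie) dom_conv_idem // eqxx.
have [HI [_ Hm]] := Hclass_subsemigroup ie ee.
have Hi : isolated (Hclass e) by rewrite -pe; apply: Hclass_pair_isolated.
(* Both sides are isolated and contain [e] as their only idempotent, so each consists of the
   elements with [e] among their powers. *)
apply/setP => a; apply/idP/idP => [aT|aH].
  have [k k1 ake] := powe a aT.
  by apply: (Hi a k); rewrite ?ake ?(subsetP TI _ aT).
have [k k1 [ak akH]] := isolated_idem_pow HI Hm aH.
apply: (Ti a k) => //; first exact: subsetP HI _ aH.
suff -> : pow a k = e by [].
have iak := subsetP HI _ akH.
apply: idem_ext => //; move: akH; rewrite (HclassE ie ee iak).
by case/andP => /eqP.
Qed.

Theorem mainTheorem12 (n : nat) (hn : 2 <= n) (T : {set elt n}) :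
  (subsemigroup T /\ isolated T) <->
  [\/ T = Istar n, T = Sn n, T = Istar n :\: Sn n |
      exists2 e, e \in Istar n &
        [/\ is_idem e, rank e = n.-1 & T = Hclass e]].
Proof.
split=> [[Ts Ti]|[->|->|->|[e ie [ee re ->]]]].
- case: (isolated_cases Ts Ti) => [| | |[p [q [pq ->]]]]; [by constructor..|].
  constructor 4; exists (pair_idem p q); first exact: mk1_Istar.
  by split=> //; [apply: mk1_idem | apply: rank_pair].
- exact: Istar_isolated.
- exact: Sn_isolated.
- exact: nonunits_isolated.
have [p [q [pq epq]]] := idem_rank_pair (ltnW hn) ie ee re.
split; first exact: Hclass_subsemigroup.
by rewrite epq; apply: Hclass_pair_isolated.
Qed.
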